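(* Let $c<1/2$ be arbitrary. Consider $n\ge M$ with $M\to\infty$, and let $\mathcal{M}\in\{-1,1\}^{M\times n}$ have i.i.d. Rademacher entries. Then there exists $M_0\in\mathbb{N}$ such that for every $M\ge M_0$ (and every $n\ge M$) there exists no $\bigl(e^{-cM},\sqrt{M}/24\bigr)$-online algorithm for discrepancy (in the sense defined in the context).
   Context: Let $\Sigma_n=\{-1,1\}^n$. Let $\mathcal{M}\in\mathbb{R}^{M\times n}$ be a random matrix with columns $\mathcal{C}_1,\dots,\mathcal{C}_n$. For $p_s>0$ and $K>0$, an algorithm $\mathcal{A}$ mapping $\mathcal{M}$ to $\boldsymbol{\sigma}_{\rm ALG}=\mathcal{A}(\mathcal{M})\in\Sigma_n$ is $(p_s,K)$-online for discrepancy if: (Success) $\mathbb{P}\bigl[\|\mathcal{M}\boldsymbol{\sigma}_{\rm ALG}\|_\infty\le K\bigr]\ge p_s$, the probability being over $\mathcal{M}$; (Online) there exist deterministic functions $f_1,\dots,f_n$ such that for every $1\le t\le n$, $\boldsymbol{\sigma}_{\rm ALG}(t)=f_t(\mathcal{C}_1,\dots,\mathcal{C}_t)\in\{-1,1\}$. *)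

(* Defs.v *)
From mathcomp Require Import all_boot all_order all_algebra.
From mathcomp Require Import all_classical all_reals all_analysis.
Set Implicit Arguments.
Unset Strict Implicit.
Unset Printing Implicit Defensive.
Import Order.TTheory GRing.Theory Num.Theory numFieldNormedType.Exports.
Local Open Scope classical_set_scope.
Local Open Scope ring_scope.

Definition mutually_independent d (T : measurableType d) (R : realType)
    (P : probability T R) (I : finType) (Y : I -> T -> R) : Prop :=
  forall (J : {set I}) (B : I -> set R), (forall i, measurable (B i)) ->
    P (\bigcap_(i in [set` J]) (Y i @^-1` B i)) =
    (\prod_(i in J) P (Y i @^-1` B i))%E.

Definition rademacher d (T : measurableType d) (R : realType)
    (P : probability T R) (Y : T -> R) : Prop :=
  [/\ measurable_fun [set: T] Y, (forall w, Y w = -1 \/ Y w = 1),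
      P [set w | Y w = 1] = (2^-1)%:E & P [set w | Y w = -1] = (2^-1)%:E].

Definition iid_rademacher_matrix d (T : measurableType d) (R : realType)
    (P : probability T R) (m n : nat) (X : T -> 'M[R]_(m, n)) : Prop :=
  (forall i j, rademacher P (fun w => X w i j)) /\
  mutually_independent P (fun (ij : 'I_m * 'I_n) w => X w ij.1 ij.2).

Definition sign_vector (R : realType) (n : nat) (s : 'cV[R]_n) : Prop :=
  forall t, s t 0 = -1 \/ s t 0 = 1.

(* The submatrix with columns 0, ..., t; as t counts from 0, these are the
   first t.+1 columns. *)
Definition columns_upto (R : realType) (m n : nat) (A : 'M[R]_(m, n))
    (t : 'I_n) : 'M[R]_(m, t.+1) :=
  colsub (widen_ord (ltn_ord t)) A.

(* The norm `|_| of a matrix (here a column vector) is the maximum of the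
   absolute values of its entries. No measurability is required of [alg]: when
   X takes finitely many values and has measurable entries, the success event
   is automatically measurable. *)
Definition online_for_discrepancy d (T : measurableType d) (R : realType)
    (P : probability T R) (m n : nat) (X : T -> 'M[R]_(m, n)) (ps K : R)
    (alg : 'M[R]_(m, n) -> 'cV[R]_n) : Prop :=
  [/\ forall A, sign_vector (alg A),
      (ps%:E <= P [set w | (`|X w *m alg (X w)| <= K)%R])%E
    & exists f : forall t : 'I_n, 'M[R]_(m, t.+1) -> R,
        forall A t, alg A t 0 = f t (columns_upto A t)].

(* Main.v *)
(* Write n = k + M. The first k signs, hence the vector v obtained from the first
   k columns, do not depend on the last M columns. For each of the 2^M choices of
   the last M signs, every row must bring its coordinate of v into [-K, K] with a
   sum of M independent signs. That interval contains at most K + 1 values of the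
   sum, each of probability at most 1 / sqrt M. The success probability is thus
   at most (2 (K + 1) / sqrt M)^M, which for K = sqrt M / 24 and M >= 36 is less
   than 2^-M <= exp(- M / 2). *)
Require Import Defs.
From mathcomp Require Import all_boot all_order all_algebra.
From mathcomp Require Import all_classical all_reals all_analysis.
From mathcomp Require Import zify ring lra.
Import Order.TTheory GRing.Theory Num.Theory numFieldNormedType.Exports.
Local Open Scope classical_set_scope.
Local Open Scope ring_scope.

(** * Bounds on binomial coefficients *)

Lemma leq_bin_succ (n j : nat) : (j.*2 < n)%N -> ('C(n, j) <= 'C(n, j.+1))%N.
Proof.
move=> lt_jn; rewrite -(leq_pmul2l (ltn0Sn j)) mul_bin_left.
by rewrite leq_mul2r; apply/orP; right; lia.
Qed.

(** Unimodality: [leq_bin_succ] climbs to the middle, and symmetry handles the upper half. *)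
Lemma leq_bin_half (h j : nat) : ('C(h.*2, j) <= 'C(h.*2, h))%N.
Proof.
have low i : (i <= h)%N -> ('C(h.*2, i) <= 'C(h.*2, h))%N.
  move=> le_ih; rewrite -(subKn le_ih); elim: (h - i)%N => [|e IHe].
    by rewrite subn0.
  have [le_he|lt_eh] := leqP h e.
    by move: IHe; rewrite (_ : h - e.+1 = h - e)%N //; lia.
  apply: leq_trans IHe; rewrite (_ : h - e = (h - e.+1).+1)%N; last by lia.
  by apply: leq_bin_succ; lia.
have [/low //|lt_hj] := leqP j h.
have [le_j2h|lt_2hj] := leqP j h.*2; last by rewrite bin_small.
by rewrite -bin_sub //; apply: low; lia.
Qed.

Lemma mul_central_bin_succ (h : nat) :
  (h.+1 * 'C(h.+1.*2, h.+1) = 2 * h.*2.+1 * 'C(h.*2, h))%N.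
Proof.
have e1 := mul_bin_diag h.*2.+2 h; have e2 := mul_bin_down h.*2.+1 h.
rewrite /= in e1 e2; rewrite doubleS -e1.
have e3 : (h.*2.+1 - h = h.+1)%N by lia.
by rewrite e3 in e2; nia.
Qed.

(** Induction on [h]: the left side is multiplied by [4 (2h+1) (2h+3) / (h+1)^2], which is below 16
    because [(2h+1) (2h+3) = 4 (h+1)^2 - 1]. *)
Lemma central_bin_sqr_le (h : nat) :
  ('C(h.*2, h) ^ 2 * h.*2.+1 <= 4 ^ h.*2)%N.
Proof.
elim: h => [|h IHh] //; have e := mul_central_bin_succ h.
have sqr_gt0 : (0 < h.+1 ^ 2)%N by rewrite expn_gt0.
rewrite -(leq_pmul2l sqr_gt0) mulnA -expnMn e.
rewrite doubleS !expnS; move: IHh.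
set b := 'C(_, _); set q := (4 ^ _)%N => IHh.
rewrite expn0 !muln1 -!muln2 in IHh *.
have := leq_mul (leqnn (4 * (h * 2).+1 * (h * 2).+3)%N) IHh.
rewrite expnS expn1.
by nia.
Qed.

Lemma bin_sqr_le (p j : nat) : ('C(p, j) ^ 2 * p <= 4 ^ p)%N.
Proof.
have even h i : ('C(h.*2, i) ^ 2 * h.*2.+1 <= 4 ^ h.*2)%N.
  apply: leq_trans (central_bin_sqr_le h).
  by rewrite leq_mul2r leq_exp2r ?leq_bin_half ?orbT.
rewrite -(odd_double_half p); set h := p./2; case: (odd p) => /=; last first.
  by apply: leq_trans (even h j); rewrite leq_mul2l leqnSn orbT.
rewrite add1n [(4 ^ _)%N]expnS; case: j => [|j].
  apply: leq_trans (leq_mul (isT : 1 <= 4)%N (even h 0)).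
  by rewrite !bin0 !exp1n !mul1n.
(* For [p = 2h+1], Pascal's rule gives two coefficients of row [2h], each at most the central one;
   the resulting factor 2, once squared, is the extra factor 4 on the right. *)
rewrite binS; apply: leq_trans (leq_mul (leqnn 4) (central_bin_sqr_le h)).
rewrite mulnA leq_mul2r -(expnMn 2 _ 2) leq_exp2r //; apply/orP; right.
by rewrite mul2n -[X in (_ <= X)%N]addnn leq_add ?leq_bin_half.
Qed.

(** * Sums of signs and their anti-concentration *)

Definition sgb (R : realType) (b : bool) : R := if b then 1 else -1.

Lemma sgbM (R : realType) (a b : bool) : sgb R a * sgb R b = sgb R (a == b).
Proof. by case: a b => [] []; rewrite /sgb /= ?mulr1 ?mul1r ?mulrN1 ?opprK. Qed.

Lemma sum_sgb (R : realType) (p : nat) (u : {set 'I_p}) :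
  \sum_j sgb R (j \in u) = #|u|%:R *+ 2 - p%:R.
Proof.
rewrite (eq_bigr (fun j => (j \in u)%:R *+ 2 - 1)) => [|j _]; last first.
  by rewrite /sgb; case: (j \in u); rewrite ?mul0rn ?mulr2n ?addrK ?sub0r.
rewrite sumrB sumrMnl sumr_const card_ord; congr (_ *+ 2 - _).
by rewrite -sum1_card natr_sum [RHS]big_mkcond; apply: eq_bigr => j _; case: ifP.
Qed.

(** Subtracting the least element of [J] injects [J] into the integers from 0 to the floor of
    [K]. *)
Lemma card_ord_diameter_le (R : realType) (p : nat) (J : {set 'I_p}) (K : R) :
  0 <= K ->
  (forall i j, i \in J -> j \in J -> (j%:R - i%:R <= K)) ->
  #|J|%:R <= K + 1.
Proof.
move=> K_ge0 diam; have [x0 Jx0|J0] := pickP [in J]; last by rewrite eq_card0 // addr_ge0.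
pose i0 := [arg min_(i < x0 in J) val i]%N.
have [Ji0 min_i0] : i0 \in J /\ forall j, j \in J -> (i0 <= j)%N.
  by rewrite /i0; case: arg_minnP.
pose N := Num.truncn K.
have ltN j : j \in J -> (j - i0 < N.+1)%N.
  move=> Jj; rewrite ltnS /N truncn_ge_nat // natrB ?min_i0 //.
  exact: diam.
have inj : {in J &, injective (fun j : 'I_p => inord (j - i0) : 'I_N.+1)}.
  move=> j j' Jj Jj' /(congr1 val) /=; rewrite !inordK ?ltN // => e.
  by apply: val_inj; have := min_i0 _ Jj; have := min_i0 _ Jj'; rewrite /=; lia.
have : (#|J| <= N.+1)%N.
  by rewrite -(card_in_imset inj) -[X in (_ <= X)%N]card_ord max_card.
rewrite -(ler_nat R) => /le_trans; apply.
by rewrite -natr1 lerD2r /N truncn_le.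
Qed.

Lemma bin_le_sqrt (R : realType) (p j : nat) : (0 < p)%N ->
  'C(p, j)%:R <= 2 ^+ p / Num.sqrt p%:R :> R.
Proof.
move=> p_gt0; have sp_gt0 : 0 < Num.sqrt p%:R :> R by rewrite sqrtr_gt0 ltr0n.
rewrite ler_pdivlMr // -(@ler_pXn2r R 2) ?nnegrE //.
rewrite exprMn sqr_sqrtr ?ler0n // -exprM mulnC exprM -!natrX -natrM ler_nat.
exact: bin_sqr_le.
Qed.

(* Anti-concentration: a sum of [p] signs is [2 * #|u| - p], where [u] is the
   set of its positive terms. *)
Lemma card_sum_in_window (R : realType) (p : nat) (v K : R) :
  (0 < p)%N -> 0 <= K ->
  #|[set u : {set 'I_p} | `|v + (#|u|%:R *+ 2 - p%:R)| <= K]%SET|%:R <=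
  (K + 1) * (2 ^+ p / Num.sqrt p%:R).
Proof.
move=> p_gt0 K_ge0.
pose J := [set j : 'I_p.+1 | `|v + (j%:R *+ 2 - p%:R)| <= K]%SET.
have cardJ : #|J|%:R <= K + 1.
  (* Two sums in the window differ by at most [2K]; as a sum is [2j - p], the sizes [j] differ by at
     most [K]. *)
  apply: card_ord_diameter_le => // i j; rewrite !inE !ler_norml.
  move=> /andP[i1 i2] /andP[j1 j2]; rewrite !mulr2n in i1 i2 j1 j2.
  by lra.
have lt_card (u : {set 'I_p}) : (#|u| < p.+1)%N.
  by rewrite ltnS -[X in (_ <= X)%N]card_ord max_card.
pose size_of (u : {set 'I_p}) : 'I_p.+1 := inord #|u|.
(* Group the subsets by size: at most [K + 1] sizes occur, each shared by a binomial number of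
   subsets. *)
rewrite -sum1_card natr_sum (partition_big size_of (mem J)) /=; last first.
  by move=> u; rewrite !inE /size_of inordK.
apply: le_trans (ler_wpM2r _ cardJ); last by rewrite divr_ge0 ?exprn_ge0 ?sqrtr_ge0.
rewrite -sum1_card natr_sum mulr_suml; apply: ler_sum => j _.
rewrite mul1r; apply: le_trans (bin_le_sqrt _ _ j p_gt0).
rewrite -natr_sum ler_nat sum1_card -[p in 'C(p, _)]card_ord -card_draws.
apply: subset_leq_card; apply/fintype.subsetP => u; rewrite !inE => /andP[_ /eqP <-].
by rewrite /size_of inordK.
Qed.

(** * Counting the sign matrices on which an online algorithm succeeds *)

Definition sgmx (R : realType) {m n : nat} (A : 'M[bool]_(m, n)) :
    'M[R]_(m, n) := map_mx (sgb R) A.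

Section OnlineCount.
Variables (R : realType) (m k p : nat).
Variable alg : 'M[R]_(m, k + p) -> 'cV[R]_(k + p).
Hypothesis alg_sign : forall A, sign_vector (alg A).
Hypothesis alg_online : exists f : forall t : 'I_(k + p), 'M[R]_(m, t.+1) -> R,
  forall A t, alg A t 0 = f t (columns_upto A t).

(** The sign at time [t < k] is a function of columns 0 to [t], all of which lie in the left
    block. *)
Lemma online_usubmx (A A' : 'M[R]_(m, k + p)) :
  lsubmx A = lsubmx A' -> usubmx (alg A) = usubmx (alg A').
Proof.
move=> eqA; have [f algE] := alg_online.
apply/matrixP => t j; rewrite !mxE ord1 !algE; congr (f _ _).
apply/matrixP => i s; rewrite !mxE.
have lt_sk : (s < k)%N by apply: leq_trans (ltn_ord s) _; rewrite /= ltn_ord.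
have -> : widen_ord (ltn_ord (lshift p t)) s = lshift p (Ordinal lt_sk).
  exact: val_inj.
by have /matrixP/(_ i (Ordinal lt_sk)) := eqA; rewrite !mxE.
Qed.

(* The contribution of the first [k] columns, which no longer depends on the
   last [p] ones. *)
Let head (B : 'M[bool]_(m, k)) : 'cV[R]_m :=
  sgmx R B *m usubmx (alg (sgmx R (row_mx B (const_mx false)))).

Let tail_signs (A : 'M[bool]_(m, k + p)) : {set 'I_p} :=
  [set j | dsubmx (alg (sgmx R A)) j 0 == 1]%SET.

Let agree (s : {set 'I_p}) (a : 'I_p -> bool) : {set 'I_p} :=
  [set j | a j == (j \in s)]%SET.

(* A row [a] of the last block contributes [2 * #|agree s a| - p] when the last
   signs are [s]; for fixed [s] this change of coordinates is injective. *)
Let recode (s : {set 'I_p}) (A : 'M[bool]_(m, k + p)) :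
    'M[bool]_(m, k) * {ffun 'I_m -> {set 'I_p}} :=
  (lsubmx A, [ffun i => agree s (rsubmx A i)]).

Let recode_inj s : injective (recode s).
Proof.
move=> A A' [eql /ffunP eqr]; rewrite -(hsubmxK A) -(hsubmxK A') eql.
congr row_mx; apply/matrixP => i j; have := eqr i.
rewrite !ffunE => /setP/(_ j); rewrite !inE.
by case: (j \in s) (rsubmx A i j) (rsubmx A' i j) => [] [] [].
Qed.

Let output_entry (A : 'M[bool]_(m, k + p)) (i : 'I_m) :
  (sgmx R A *m alg (sgmx R A)) i 0 =
  head (lsubmx A) i 0 +
  (#|agree (tail_signs A) (rsubmx A i)|%:R *+ 2 - p%:R).
Proof.
have tailE j : dsubmx (alg (sgmx R A)) j 0 = sgb R (j \in tail_signs A).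
  rewrite inE /sgb; case: eqP => // ne1.
  by rewrite !mxE in ne1 *; case: (alg_sign (sgmx R A) (rshift k j)).
rewrite -(vsubmxK (alg _)) -{1}(hsubmxK (sgmx R A)) mul_row_col mxE.
congr (_ + _).
  (* [head] runs the algorithm with an arbitrary filler for the last columns; being online makes the
     first signs insensitive to it. *)
  rewrite /head /sgmx map_lsubmx; congr ((_ *m _) i 0); apply: online_usubmx.
  by rewrite -!map_lsubmx row_mxKl.
(* A product of two signs is 1 exactly when they agree, so the last block contributes a signed count
   of agreements. *)
rewrite -sum_sgb mxE; apply: eq_bigr => j _.
by rewrite tailE [in RHS]inE -sgbM; congr (_ * _); rewrite !mxE.
Qed.

(** The last signs depend on the matrix, so the count is split over their [2 ^ p] possible values
    [s]. For each, [recode s] injects the successful matrices into pairs of a left block and one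
    window element per row. *)
Lemma card_online_success (K : R) : (0 < p)%N -> 0 <= K ->
  #|[set A : 'M[bool]_(m, k + p) |
      `|sgmx R A *m alg (sgmx R A)| <= K]%SET|%:R <=
  2 ^+ p * (2 ^+ (m * k) * ((K + 1) * (2 ^+ p / Num.sqrt p%:R)) ^+ m) :> R.
Proof.
move=> p_gt0 K_ge0.
pose C := (K + 1) * (2 ^+ p / Num.sqrt p%:R) : R.
set S := [set _ | _]%SET.
pose window (v : R) :=
  [set u : {set 'I_p} | `|v + (#|u|%:R *+ 2 - p%:R)| <= K]%SET.
pose good B := [pred b : {ffun 'I_m -> {set 'I_p}} |
  [forall i, b i \in window (head B i 0)]].
have card_good B : #|good B|%:R <= C ^+ m.
  have -> : #|good B| = #|family (fun i => mem (window (head B i 0)))|.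
    by apply: eq_card => b; rewrite !inE.
  rewrite card_family foldrE big_map natr_prod.
  have -> : C ^+ m = \prod_(i <- enum 'I_m) C.
    by rewrite big_enum prodr_const card_ord.
  by apply: ler_prod => i _; rewrite ler0n card_sum_in_window.
have sub s : (#|[set A in S | tail_signs A == s]%SET| <= \sum_B #|good B|)%N.
  rewrite -(card_imset _ (@recode_inj s)).
  have -> : (\sum_B #|good B|)%N = #|[set x | good x.1 x.2]%SET|.
    rewrite -sum1_card.
    rewrite (eq_bigr (fun B => \sum_(b | good B b) 1)%N); last first.
      by move=> B _; rewrite sum1_card.
    by rewrite pair_big_dep /=; apply: eq_bigl => x; rewrite inE.
  apply: subset_leq_card; apply/fintype.subsetP => x /imsetP[A].
  rewrite !inE => /andP[normA /eqP <-] ->; apply/forallP => i /=.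
  rewrite ffunE inE -output_entry; apply: le_trans normA.
  rewrite [leRHS]/Num.norm /= mx_normrE.
  by apply/bigmax_geP; right; exists (i, 0).
rewrite -sum1_card (partition_big tail_signs predT) //= natr_sum.
apply: (@le_trans _ _ (\sum_(s : {set 'I_p}) 2 ^+ (m * k) * C ^+ m)); last first.
  rewrite sumr_const -cardsT -powersetT card_powerset cardsT card_ord.
  by rewrite -[leLHS]mulr_natl natrX.
apply: ler_sum => s _.
have -> : 2 ^+ (m * k) * C ^+ m = \sum_(B : 'M[bool]_(m, k)) C ^+ m.
  by rewrite sumr_const card_mx card_bool -[RHS]mulr_natl natrX.
apply: le_trans (ler_sum _ (fun B _ => card_good B)).
rewrite -natr_sum ler_nat; apply: leq_trans (sub s).
by rewrite -sum1_card; apply: eq_leq; apply: eq_bigl => A; rewrite inE.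
Qed.

End OnlineCount.

(** * From probabilities to counting *)

Section RademacherMatrix.
Variables (d : measure_display) (T : measurableType d) (R : realType).
Variables (P : probability T R) (m n : nat) (X : T -> 'M[R]_(m, n)).
Hypothesis iidX : iid_rademacher_matrix P X.

Let entry_eq (A : 'M[bool]_(m, n)) (ij : 'I_m * 'I_n) : set T :=
  (fun w => X w ij.1 ij.2) @^-1` [set sgb R (A ij.1 ij.2)].

Let matrix_eqE (A : 'M[bool]_(m, n)) :
  [set w | X w = sgmx R A] =
  \bigcap_(ij in [set` [set: 'I_m * 'I_n]%SET]) entry_eq A ij.
Proof.
apply/seteqP; split => w /= => [XA ij _|XA].
  by rewrite /entry_eq /= XA mxE.
by apply/matrixP => i j; rewrite mxE; apply: (XA (i, j)); rewrite /= inE.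
Qed.

Let matrix_eq_measurable (A : 'M[bool]_(m, n)) :
  measurable [set w | X w = sgmx R A].
Proof.
rewrite matrix_eqE; apply: fin_bigcap_measurable => [|ij _]; first exact: finite_finpred.
have [mX _ _ _] := iidX.1 ij.1 ij.2.
by rewrite /entry_eq -[_ @^-1` _]setTI; apply: mX.
Qed.

Lemma prob_matrix_eq (A : 'M[bool]_(m, n)) :
  P [set w | X w = sgmx R A] = (2^-1 ^+ (m * n))%:E.
Proof.
rewrite matrix_eqE.
rewrite (iidX.2 _ (fun ij => [set sgb R (A ij.1 ij.2)])) //.
rewrite (eq_bigr (fun=> (2^-1 : R)%:E)) => [|ij _].
  rewrite prodEFin prodr_const; congr ((_ ^+ _)%:E).
  by rewrite cardsT card_prod !card_ord.
have [_ _ P1 PN1] := iidX.1 ij.1 ij.2.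
by rewrite /sgb; case: (A _ _); [exact: P1|exact: PN1].
Qed.

(** [X] takes only sign matrices as values, all equally likely, so the event is a finite disjoint
    union of measurable atoms whatever [Q] is. *)
Lemma prob_matrix_pred (Q : pred 'M[R]_(m, n)) :
  P [set w | Q (X w)] =
  (#|[set A | Q (sgmx R A)]%SET|%:R / 2 ^+ (m * n))%:E.
Proof.
set S := [set _ | _]%SET.
have -> : [set w | Q (X w)] = \bigcup_(A in [set` enum S]) [set w | X w = sgmx R A].
  apply/seteqP; split => w /= => [QX|[A /= + ->]]; last by rewrite mem_enum inE.
  have XE : X w = sgmx R (\matrix_(i, j) (X w i j == 1)).
    apply/matrixP => i j; rewrite !mxE /sgb.
    have [_ /(_ w) [->|->] _ _] := iidX.1 i j; last by rewrite eqxx.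
    by rewrite eqNr oner_eq0.
  by exists (\matrix_(i, j) (X w i j == 1)); rewrite //= mem_enum inE -XE.
rewrite measure_fin_bigcup //.
- rewrite -fsbig_seq ?enum_uniq // big_enum /=.
  rewrite (eq_bigr (fun=> (2^-1 ^+ (m * n) : R)%:E)) => [|A _]; last first.
    exact: prob_matrix_eq.
  by rewrite sumEFin sumr_const exprVn -[X in X%:E = _]mulr_natl.
- move=> A A' _ _ [w [/= -> /matrixP eqA]]; apply/matrixP => i j.
  by have := eqA i j; rewrite !mxE /sgb; case: (A i j) (A' i j) => [] [] //; lra.
Qed.

End RademacherMatrix.

(** * Bound on the success probability and choice of constants *)

Lemma online_success_prob_le (R : realType) (m k : nat) (d : measure_display)
    (T : measurableType d) (P : probability T R) (X : T -> 'M[R]_(m, k + m))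
    (ps K : R) (alg : 'M[R]_(m, k + m) -> 'cV[R]_(k + m)) :
  (0 < m)%N -> 0 <= K -> iid_rademacher_matrix P X ->
  online_for_discrepancy P X ps K alg ->
  ps <= (2 * (K + 1) / Num.sqrt m%:R) ^+ m.
Proof.
move=> m_gt0 K_ge0 iidX [alg_sign success alg_online].
move: success.
rewrite (prob_matrix_pred _ _ _ _ _ _ _ iidX (fun A => `|A *m alg A| <= K)).
rewrite lee_fin => /le_trans; apply.
rewrite ler_pdivrMr ?exprn_gt0 //.
apply: le_trans (card_online_success _ _ _ _ _ alg_sign alg_online _ m_gt0 K_ge0) _.
(* The factor [2 ^ m] counting the last signs becomes the 2 inside the [m]-th power; [2 ^ (m * k)]
   and [2 ^ (m * m)] cancel against the number of matrices. *)
rewrite mulnDr exprD (exprM 2 m m) mulrCA [leRHS]mulrCA -!exprMn.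
set q := 2 ^+ m; set s := Num.sqrt _.
by have -> : 2 * ((K + 1) * (q / s)) = 2 * (K + 1) / s * q by ring.
Qed.

Theorem theorem2p4 (R : realType) (c : R) (hc : c < 2^-1) :
  exists M0 : nat, forall M n : nat, (M0 <= M)%N -> (M <= n)%N ->
    forall (d : measure_display) (T : measurableType d) (P : probability T R)
      (X : T -> 'M[R]_(M, n)), iid_rademacher_matrix P X ->
    ~ exists alg : 'M[R]_(M, n) -> 'cV[R]_n,
        online_for_discrepancy P X (expR (- c * M%:R)) (Num.sqrt M%:R / 24) alg.
Proof.
(* From 36 on, [sqrt M >= 6], so for [K = sqrt M / 24] the base
   [2 (K + 1) / sqrt M = 1/12 + 2 / sqrt M] is at most [5/12 < 1/2]. *)
exists 36%N => M n M_ge leMn; rewrite -(subnK leMn).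
move: (n - M)%N => k d T P X iidX [alg onl].
have M_gt0 : (0 < M)%N by apply: leq_trans M_ge.
have sqrt_ge6 : 6 <= Num.sqrt M%:R :> R.
  rewrite -(ger0_norm (ler0n R 6)) -sqrtr_sqr -natrX ler_wsqrtr // ler_nat.
  exact: leq_trans M_ge.
have K_ge0 : 0 <= Num.sqrt M%:R / 24 :> R by rewrite divr_ge0 ?sqrtr_ge0.
have := online_success_prob_le _ _ _ _ _ _ _ _ _ _ M_gt0 K_ge0 iidX onl.
apply/negP; rewrite -ltNge expRM_natr ltr_pXn2r ?nnegrE ?expR_ge0 //.
apply: (@le_lt_trans _ _ 2^-1); first by rewrite ler_pdivrMr; lra.
(* Here [c < 1/2] enters: [exp (- c) >= 1 - c > 1/2]. *)
by have := expR_ge1Dx (- c); lra.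
Qed.
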